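(* Let $(V_1,V_2)$ be a pair of commuting isometries on a Hilbert space $\mathcal H$ and $V=V_1V_2$. Then the following are equivalent: (a) $\operatorname{ran}V_1=\operatorname{ran}V_2$; (b) $V_1(\ker V_2^* )=V_2(\ker V_1^* )$; (c) the defect operator $C(V_1,V_2)$ is a difference $P_1-P_2$ of two mutually orthogonal projections $P_1,P_2$ with $\operatorname{ran}P_1\oplus\operatorname{ran}P_2=\ker V^*$; (d) the fringe operators $F_1$ and $F_2$ are zero; (e) if $(\mathcal E,P,U)$ is the BCL triple for $(V_1,V_2)$, then $U(\operatorname{ran}P)=\operatorname{ran}P^\perp$ (equivalently $U(\operatorname{ran}P^\perp)=\operatorname{ran}P$).
   Context: Defect operator: $C(V_1,V_2)=I-V_1V_1^*-V_2V_2^*+V_1V_2V_2^*V_1^*$. Fringe operators: $F_1:\ker V_1^*\to\ker V_1^*$, $F_1x=P_{\ker V_1^*}V_2x$, and $F_2:\ker V_2^*\to\ker V_2^*$, $F_2x=P_{\ker V_2^*}V_1x$. Given a Hilbert space $\mathcal E$, projection $P$ and unitary $U$ on $\mathcal E$, set $P^\perp=I-P$, $\varphi_1(z)=U^*(P^\perp+zP)$, $\varphi_2(z)=(P+zP^\perp)U$. Berger–Coburn–Lebow theorem: for commuting isometries $(V_1,V_2)$ on $\mathcal H$, $\mathcal H=\mathcal H_p\oplus\mathcal H_u$ (jointly reducing), $V_i|_{\mathcal H_u}$ commuting unitaries, and there is a triple $(\mathcal E,P,U)$, unique up to unitary equivalence, with $(V_1|_{\mathcal H_p},V_2|_{\mathcal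 H_p})$ unitarily equal to the multiplication operators $(M_{\varphi_1},M_{\varphi_2})$ on the Hardy space $H^2_{\mathbb D}(\mathcal E)$ ($\mathcal E\cong\ker V^*$); this is the BCL triple. *)

(* Defs.v *)
From mathcomp Require Import all_boot all_order all_algebra.
From mathcomp Require Import complex.
From mathcomp Require Import boolp classical_sets reals.
Set Implicit Arguments. Unset Strict Implicit. Unset Printing Implicit Defensive.
Import Order.TTheory GRing.Theory Num.Theory.
Local Open Scope ring_scope.
Local Open Scope classical_set_scope.

Section Hilbert.
Variable R : realType.
Local Notation C := R[i].

Definition is_hilbert (H : lmodType C) (dot : H -> H -> C) : Prop :=
  [/\ (forall (a : C) (x y z : H), dot (a *: x + y) z = a * dot x z + dot y z),
      (forall x y : H, dot y x = Num.conj (dot x y)),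
      (forall x : H, 0 <= dot x x),
      (forall x : H, dot x x = 0 -> x = 0) &
      (forall u : nat -> H,
         (forall e : C, 0 < e -> exists N, forall m n, (N <= m)%N -> (N <= n)%N ->
              dot (u m - u n) (u m - u n) < e) ->
         exists l : H, forall e : C, 0 < e -> exists N, forall n, (N <= n)%N ->
              dot (u n - l) (u n - l) < e)].

Variable H : lmodType C.
Variable dot : H -> H -> C.

Definition is_adjoint (T Ts : H -> H) : Prop :=
  forall x y, dot (T x) y = dot x (Ts y).

Definition is_isometry (T : H -> H) : Prop :=
  forall x, dot (T x) (T x) = dot x x.

Definition is_proj (P : H -> H) : Prop :=
  is_adjoint P P /\ (forall x, P (P x) = P x).

Definition ker (T : H -> H) : set H := [set x | T x = 0].

Definition defect (V1 V2 V1s V2s : H -> H) (x : H) : H :=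
  x - V1 (V1s x) - V2 (V2s x) + V1 (V2 (V2s (V1s x))).

End Hilbert.

Section Hardy.
Variable R : realType.
Local Notation C := R[i].

Definition series_to (u : nat -> C) (l : C) : Prop :=
  forall e : C, 0 < e -> exists N, forall n, (N <= n)%N ->
    `|\sum_(i < n) u i - l| < e.

Variable E : lmodType C.
Variable dotE : E -> E -> C.

(* H^2_D(E), identified with E-valued power series sum_n f_n z^n whose
   coefficient sequences are square summable *)
Definition hardy : set (nat -> E) :=
  [set f : nat -> E | exists M : C, forall n, \sum_(i < n) dotE (f i) (f i) <= M].

(* coefficients of z * f *)
Definition shiftz (f : nat -> E) : nat -> E :=
  fun n => if n is m.+1 then f m else 0.

(* multiplication by the linear operator-valued function phi(z) = A + z B *)
Definition mult_lin (A B : E -> E) (f : nat -> E) : nat -> E :=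
  fun n => A (f n) + B (shiftz f n).

(* phi_1(z) = U^*(P^perp + z P),  phi_2(z) = (P + z P^perp) U *)
Definition M_phi1 (P Us : E -> E) : (nat -> E) -> nat -> E :=
  mult_lin (fun x => Us (x - P x)) (fun x => Us (P x)).
Definition M_phi2 (P U : E -> E) : (nat -> E) -> nat -> E :=
  mult_lin (fun x => P (U x)) (fun x => U x - P (U x)).

End Hardy.

(* (E, P, U) is a BCL triple for the commuting isometries (V1, V2) on H:
   H = H_p (+) H_u (orthogonal, given by the orthogonal projection Q onto H_p),
   both jointly reducing, V_i|H_u unitary, and (V1|H_p, V2|H_p) unitarily
   equivalent (via W) to (M_phi1, M_phi2) on H^2_D(E). *)
Definition BCL_triple (R : realType) (H : lmodType R[i]) (dot : H -> H -> R[i])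
    (V1 V2 V1s V2s : H -> H)
    (E : lmodType R[i]) (dotE : E -> E -> R[i]) (P U Us : E -> E) : Prop :=
  [/\ is_hilbert dotE, is_proj dotE P,
      is_adjoint dotE U Us /\ (forall x, U (Us x) = x) /\ (forall x, Us (U x) = x) &
  exists (Q : H -> H) (W : H -> nat -> E),
    let Hp := range Q in
    let Hu := range (fun x => x - Q x) in
    [/\ is_proj dot Q,
        [/\ V1 @` Hp `<=` Hp, V1s @` Hp `<=` Hp, V2 @` Hp `<=` Hp & V2s @` Hp `<=` Hp] /\
        [/\ V1 @` Hu `<=` Hu, V1s @` Hu `<=` Hu, V2 @` Hu `<=` Hu & V2s @` Hu `<=` Hu],
        (* V1|H_u, V2|H_u are (commuting) unitaries *)
        V1 @` Hu = Hu /\ V2 @` Hu = Hu,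
        [/\ (forall (a : R[i]) x y, Hp x -> Hp y -> forall n, W (a *: x + y) n = a *: W x n + W y n),
            (forall x, Hp x -> hardy dotE (W x)),
            (forall x, Hp x -> series_to (fun n => dotE (W x n) (W x n)) (dot x x)) &
            (forall f, hardy dotE f -> exists2 x, Hp x & W x = f)] &
        forall x, Hp x -> W (V1 x) = M_phi1 P Us (W x) /\ W (V2 x) = M_phi2 P U (W x)]].

(* Main.v *)
Require Import Defs.
From HB Require Import structures.
From mathcomp Require Import all_boot all_order all_algebra.
From mathcomp Require Import complex ring.
From mathcomp Require Import boolp classical_sets reals.
Import Order.TTheory GRing.Theory Num.Theory.
Local Open Scope ring_scope.
Local Open Scope classical_set_scope.

(** Write [A], [B] for the projections on [ker V1^*], [ker V2^*]; every
    condition turns out to say [A = B]. For (c), [P1 - P2 = C(V1, V2)] and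
    [P1 + P2 = I - V V^*] give [2 P1 = A + B], and an average of two projections
    is a projection only if they coincide. In the model on [H^2(E)],
    [ker V1^*] and [ker V2^*] are the constants in [U^* ran P] and [ran P^perp],
    so that (d) says that [U] exchanges [ran P] and [ran P^perp].
    Since (e) quantifies over all BCL triples, (e) -> (a) needs one to exist.
    It is built on [E = ker V^*], with [P] the restriction of [V2 V2^*] and
    [U = V2 A + V1^*]; the Wold decomposition of [V] provides the unitary part,
    the intersection of the ranges of the [V^n], and the coefficients
    [(I - V V^* ) V^*^n x] identify its complement with [H^2(E)]. *)

(** * Inner products, Cauchy-Schwarz and limits of sequences *)

Section InnerProduct.
Context {R : realType} {H : lmodType R[i]} {dot : H -> H -> R[i]}.
Hypothesis hilb : is_hilbert dot.

Lemma dotZDl a x y z : dot (a *: x + y) z = a * dot x z + dot y z.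
Proof. by case: hilb. Qed.

Lemma dotC x y : dot y x = Num.conj (dot x y).
Proof. by case: hilb. Qed.

Lemma dot_ge0 x : 0 <= dot x x.
Proof. by case: hilb. Qed.

Lemma dot_eq0 x : dot x x = 0 -> x = 0.
Proof. by case: hilb => _ _ _ + _; exact. Qed.

Lemma dotDl x y z : dot (x + y) z = dot x z + dot y z.
Proof. by rewrite -[x]scale1r dotZDl mul1r scale1r. Qed.

Lemma dot0l z : dot 0 z = 0.
Proof. by apply: (addrI (dot 0 z)); rewrite -dotDl !addr0. Qed.

Lemma dotZl a x z : dot (a *: x) z = a * dot x z.
Proof. by rewrite -[a *: x]addr0 dotZDl dot0l addr0. Qed.

Lemma dotNl x z : dot (- x) z = - dot x z.
Proof. by rewrite -scaleN1r dotZl mulN1r. Qed.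

Lemma dotBl x y z : dot (x - y) z = dot x z - dot y z.
Proof. by rewrite dotDl dotNl. Qed.

Lemma dot0r z : dot z 0 = 0.
Proof. by rewrite dotC dot0l rmorph0. Qed.

Lemma dotDr x y z : dot x (y + z) = dot x y + dot x z.
Proof. by rewrite ![dot x _]dotC dotDl rmorphD. Qed.

Lemma dotZr a x z : dot x (a *: z) = Num.conj a * dot x z.
Proof. by rewrite ![dot x _]dotC dotZl rmorphM. Qed.

Lemma dotNr x z : dot x (- z) = - dot x z.
Proof. by rewrite ![dot x _]dotC dotNl rmorphN. Qed.

Lemma dotBr x y z : dot x (y - z) = dot x y - dot x z.
Proof. by rewrite dotDr dotNr. Qed.

Lemma dot_inj x y : (forall z, dot x z = dot y z) -> x = y.
Proof.
move=> xy; apply/eqP; rewrite -subr_eq0; apply/eqP/dot_eq0.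
by rewrite dotBl xy subrr.
Qed.

Lemma dot_eq0C x y : dot x y = 0 -> dot y x = 0.
Proof. by move=> xy; rewrite dotC xy rmorph0. Qed.

Lemma pythagoras p q : dot p q = dot q q ->
  dot (p - q) (p - q) = dot p p - dot q q.
Proof.
move=> pq; have qp : dot q p = dot q q.
  by rewrite dotC pq -dotC.
by rewrite dotBl !dotBr pq qp subrr subr0.
Qed.

(** By the parallelogram law the gap is the squared norm of [x - y]. This serves as a triangle
    inequality free of square roots. *)
Lemma dotD_le x y : dot (x + y) (x + y) <= 2 * (dot x x + dot y y).
Proof.
rewrite -subr_ge0; suff -> : 2 * (dot x x + dot y y) - dot (x + y) (x + y)
  = dot (x - y) (x - y) by exact: dot_ge0.
by rewrite dotBl !dotBr !dotDl !dotDr; ring.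
Qed.

Lemma cauchy_schwarz x y :
  `|dot x y| ^+ 2 <= dot x x * dot y y.
Proof.
have [/dot_eq0 ->|y0] := eqVneq (dot y y) 0.
  by rewrite dot0r normr0 expr0n /= dot0r mulr0.
have ypos : 0 < dot y y by rewrite lt_def y0 dot_ge0.
have := dot_ge0 (dot y y *: x - dot x y *: y).
have -> : dot (dot y y *: x - dot x y *: y) (dot y y *: x - dot x y *: y)
  = dot y y * (dot x x * dot y y - `|dot x y| ^+ 2).
  rewrite !dotBl !dotBr !dotZl !dotZr normCK -[dot y y]ger0_norm ?dot_ge0 //.
  rewrite (dotC x y) conj_normC; ring.
by rewrite pmulr_rge0 // subr_ge0.
Qed.

Definition converges (u : nat -> H) (l : H) : Prop :=
  forall e : R[i], 0 < e -> exists N, forall n, (N <= n)%N ->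
    dot (u n - l) (u n - l) < e.

(** Pairing with [w] is continuous, by Cauchy-Schwarz applied to [u n - l] and [w]. *)
Lemma converges_dot u l w c : converges u l ->
  (exists N, forall n, (N <= n)%N -> dot (u n) w = c) -> dot l w = c.
Proof.
move=> ul [N Nw]; apply/eqP; rewrite -subr_eq0; apply/negPn/negP => d0.
have dpos : 0 < `|dot l w - c| ^+ 2 by rewrite exprn_gt0 // normr_gt0.
have wpos : 0 < dot w w.
  rewrite lt_def dot_ge0 andbT; apply: contra_neq d0 => /dot_eq0 w0.
  by rewrite -(Nw N (leqnn N)) w0 !dot0r subrr.
have [M HM] := ul _ (divr_gt0 dpos wpos).
have /HM := leq_maxr N M; rewrite ltr_pdivlMr //.
have := cauchy_schwarz (u (maxn N M) - l) w.
rewrite dotBl Nw ?leq_maxl // distrC => h1 h2.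
by have := le_lt_trans h1 h2; rewrite ltxx.
Qed.

Lemma nonneg_small_eq0 (c : R[i]) :
  0 <= c -> (forall e, 0 < e -> c < e) -> c = 0.
Proof.
move=> c0 ce; apply/eqP/negPn/negP => cn0.
by have := ce c; rewrite lt_def cn0 c0 ltxx => /(_ isT).
Qed.

Lemma converges_unique u l l' : converges u l -> converges u l' -> l = l'.
Proof.
move=> ul ul'; apply/eqP; rewrite -subr_eq0; apply/eqP/dot_eq0.
apply: nonneg_small_eq0 (dot_ge0 _) _ => e e0.
have e4 : 0 < e / 4 by rewrite divr_gt0.
have [N HN] := ul _ e4; have [N' HN'] := ul' _ e4.
have h1 := HN _ (leq_maxl N N'); have h2 := HN' _ (leq_maxr N N').
set n := maxn N N' in h1 h2.
have -> : l - l' = (u n - l') + - (u n - l).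
  by rewrite opprB [RHS]addrC addrA subrK.
apply: le_lt_trans (dotD_le _ _) _; rewrite dotNl dotNr opprK.
have -> : e = 2 * (e / 4 + e / 4) by field.
by rewrite ltr_pM2l // ltrD.
Qed.

Lemma converges_contraction (T : H -> H) u l :
  (forall x y, T (x - y) = T x - T y) -> (forall x, dot (T x) (T x) <= dot x x) ->
  converges u l -> converges (T \o u) (T l).
Proof.
move=> TB Tle ul e e0; have [N HN] := ul e e0; exists N => n Nn.
by rewrite /= -TB; exact: le_lt_trans (Tle _) (HN _ Nn).
Qed.

Lemma eventually_const_converges u l :
  (exists N, forall n, (N <= n)%N -> u n = l) -> converges u l.
Proof.
by case=> N HN e e0; exists N => n /HN ->; rewrite subrr dot0l.
Qed.

Lemma eq_converges u v l : (exists N, forall n, (N <= n)%N -> u n = v n) ->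
  converges u l -> converges v l.
Proof.
move=> [N HN] ul e e0; have [M HM] := ul e e0; exists (maxn N M) => n.
by rewrite geq_max => /andP[/HN <- /HM].
Qed.

End InnerProduct.

Arguments converges {R H} dot u l.

(** * Operators with an adjoint, and polarization *)

Section Adjoint.
Context {R : realType} {H : lmodType R[i]} {dot : H -> H -> R[i]}.
Hypothesis hilb : is_hilbert dot.
Context {T Ts : H -> H}.
Hypothesis adjT : is_adjoint dot T Ts.

Lemma adjoint_sym : is_adjoint dot Ts T.
Proof. by move=> x y; rewrite (dotC hilb) -adjT -(dotC hilb). Qed.

(** Linearity comes from the adjoint: once [T] is moved to the other argument, linearity of the
    inner product remains. *)
Lemma adjointP a x y : T (a *: x + y) = a *: T x + T y.
Proof.
by apply: (dot_inj hilb) => z; rewrite adjT !(dotZDl hilb) !adjT.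
Qed.

Lemma adjoint0 : T 0 = 0.
Proof. by apply: (dot_inj hilb) => z; rewrite adjT !(dot0l hilb). Qed.

Lemma adjointD x y : T (x + y) = T x + T y.
Proof. by rewrite -[x]scale1r adjointP !scale1r. Qed.

Lemma adjointZ a x : T (a *: x) = a *: T x.
Proof. by rewrite -[a *: x]addr0 adjointP adjoint0 addr0. Qed.

Lemma adjointN x : T (- x) = - T x.
Proof. by rewrite -scaleN1r adjointZ scaleN1r. Qed.

Lemma adjointB x y : T (x - y) = T x - T y.
Proof. by rewrite adjointD adjointN. Qed.

End Adjoint.

Section Polarization.
Context {R : realType} {H E : lmodType R[i]}.
Context {dot : H -> H -> R[i]} {dotE : E -> E -> R[i]}.
Hypotheses (hilb : is_hilbert dot) (hilbE : is_hilbert dotE).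

(** Only increments of squared norms are compared, so [x] and [w] may have different norms; a vector
    can thus be compared with a single coefficient of its power series. *)
Lemma polarization x y w e :
  (forall a, dot (a *: y + x) (a *: y + x) - dotE (a *: e + w) (a *: e + w)
           = dot x x - dotE w w) ->
  dot x y = dotE w e.
Proof.
move=> h; set d := dot x y - dotE w e.
have key a : `|a| ^+ 2 * (dot y y - dotE e e) + (Num.conj a * d + a * Num.conj d) = 0.
  rewrite /d rmorphB /= -(dotC hilb) -(dotC hilbE) normCK.
  move/eqP: (h a); rewrite -subr_eq0 => /eqP <-.
  rewrite !(dotZDl hilb) !(dotZDl hilbE) !(dotDr hilb) !(dotDr hilbE).
  rewrite !(dotZr hilb) !(dotZr hilbE); ring.
(* Subtracting the cases [a = d] and [a = - d] removes the quadratic term and leaves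
   [4 |d|^2 = 0]. *)
have := key (- d); have := key d; rewrite normrN rmorphN /= => k1 k2.
have : 4 * (d * Num.conj d) = 0.
  by rewrite -[RHS](subrr (0 : R[i])) -{1}k1 -k2; ring.
move/eqP; rewrite mulf_eq0 pnatr_eq0 /= -normCK expf_eq0 /= normr_eq0.
by rewrite /d subr_eq0 => /eqP.
Qed.

End Polarization.

(** * Bounded monotone sequences, projections and isometries *)

Section MonotoneCauchy.
Context {R : realType}.

Lemma archimedeanC (x e : R[i]) : 0 < e -> 0 <= x -> exists k, x < e *+ k.
Proof.
move=> e0 x0.
have xe0 : 0 <= x / e by rewrite divr_ge0 // ltW.
have [r xer] : exists r : R, x / e = r%:C%C.
  case: (x / e) xe0 => a b; rewrite lecE /= => /andP[/eqP -> _].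
  by exists a.
exists (Num.bound r); rewrite -mulr_natl -ltr_pdivrMr // xer.
have r0 : 0 <= r by move: xe0; rewrite xer ler0c.
have -> : (Num.bound r)%:R = ((Num.bound r)%:R : R)%:C%C by rewrite rmorph_nat.
by rewrite ltcR archi_boundP.
Qed.

(** Otherwise every term is followed by one larger by at least [e], and finitely many such jumps
    exceed [M]. *)
Lemma monotone_bounded_cauchy (a : nat -> R[i]) (M e : R[i]) :
  (forall n, 0 <= a n) -> (forall m n, (m <= n)%N -> a m <= a n) ->
  (forall n, a n <= M) ->
  0 < e -> exists N, forall m n, (N <= m)%N -> (m <= n)%N -> a n - a m < e.
Proof.
move=> a0 amono aM e0; apply: contrapT => nocauchy.
have step N : exists n, (N <= n)%N /\ e <= a n - a N.
  apply: contrapT => H; apply: nocauchy; exists N => m n Nm mn.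
  have ar k l : (k <= l)%N -> a l - a k \is Num.real.
    by move=> /amono kl; rewrite ger0_real // subr_ge0.
  rewrite real_ltNge ?ar ?gtr0_real //; apply/negP => enm.
  apply: H; exists n; split; first exact: leq_trans mn.
  by apply: le_trans enm _; rewrite lerD2l lerN2 amono.
have unb k : exists n, e *+ k <= a n.
  elim: k => [|k [n kn]]; first by exists 0%N; rewrite mulr0n.
  have [p [_ ep]] := step n; exists p.
  by rewrite mulrS -[a p](subrK (a n)) lerD.
have [k Mk] := archimedeanC _ _ e0 (le_trans (a0 0%N) (aM 0%N)).
have [n kn] := unb k.
by have := lt_le_trans Mk (le_trans kn (aM n)); rewrite ltxx.
Qed.

End MonotoneCauchy.

Section Projections.
Context {R : realType} {H : lmodType R[i]} {dot : H -> H -> R[i]}.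
Hypothesis hilb : is_hilbert dot.

Lemma pythagorean_cauchy_converges (u : nat -> H) (a : nat -> R[i]) (M : R[i]) :
  (forall n, 0 <= a n) -> (forall n, a n <= M) ->
  (forall m n, (m <= n)%N -> dot (u n - u m) (u n - u m) = a n - a m) ->
  exists l, converges dot u l.
Proof.
move=> a0 aM ua; have [_ _ _ _ complete] := hilb.
apply: complete => e e0.
have amono m n : (m <= n)%N -> a m <= a n.
  by move=> mn; rewrite -subr_ge0 -ua // (dot_ge0 hilb).
have [N HN] := monotone_bounded_cauchy _ _ _ a0 amono aM e0.
exists N => m n Nm Nn; have [mn|nm] := leqP m n; last first.
  by rewrite ua ?HN // ltnW.
by rewrite -opprB (dotNl hilb) (dotNr hilb) opprK ua ?HN.
Qed.

Lemma proj_range (P : H -> H) x : is_proj dot P -> range P x <-> P x = x.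
Proof.
move=> [_ PP]; split; first by case=> y _ <-; exact: PP.
by move=> <-; exists x.
Qed.

(** Each projection fixes the range of the other, so [Q P = P] and [P Q = Q]; taking adjoints in the
    first gives [P Q = P]. *)
Lemma proj_range_inj (P Q : H -> H) : is_proj dot P -> is_proj dot Q ->
  range P = range Q -> forall x, P x = Q x.
Proof.
move=> hP hQ PQ x; apply: (dot_inj hilb) => z.
have QP y : Q (P y) = P y by apply/(proj_range _ _ hQ); rewrite -PQ; exists y.
have PQ' y : P (Q y) = Q y by apply/(proj_range _ _ hP); rewrite PQ; exists y.
by case: hP hQ => [adjP _] [adjQ _]; rewrite -QP adjQ adjP PQ' adjQ.
Qed.

Lemma proj_compl (P : H -> H) : is_proj dot P -> is_proj dot (fun x => x - P x).
Proof.
move=> [adjP PP]; split=> [x y|x].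
  by rewrite (dotBl hilb) (dotBr hilb) adjP.
by rewrite (adjointB hilb adjP) PP subrr subr0.
Qed.

Lemma proj_compl_range (P : H -> H) x : is_proj dot P ->
  range (fun x => x - P x) x <-> P x = 0.
Proof.
move=> hP; rewrite (proj_range _ _ (proj_compl _ hP)); split=> [h|->].
  by apply: oppr_inj; rewrite oppr0; apply: (addrI x); rewrite h addr0.
by rewrite subr0.
Qed.

End Projections.

Section Isometry.
Context {R : realType} {H : lmodType R[i]} {dot : H -> H -> R[i]}.
Hypothesis hilb : is_hilbert dot.
Context {V Vs : H -> H}.
Hypotheses (adjV : is_adjoint dot V Vs) (isoV : is_isometry dot V).

Let adjVs := adjoint_sym hilb adjV.

Lemma isometry_dot x y : dot (V x) (V y) = dot x y.
Proof.
apply: (polarization hilb hilb) => a.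
by rewrite -(adjointP hilb adjV) !isoV !subrr.
Qed.

Lemma isometryK x : Vs (V x) = x.
Proof. by apply: (dot_inj hilb) => z; rewrite adjVs isometry_dot. Qed.

Lemma isometry_inj : injective V.
Proof. by move=> x y xy; rewrite -[x]isometryK xy isometryK. Qed.

Lemma is_proj_range_isometry : is_proj dot (fun x => V (Vs x)).
Proof.
by split=> [x y|x]; rewrite ?isometryK //= adjV adjVs.
Qed.

Lemma isometry_range x : range V x <-> V (Vs x) = x.
Proof. by split=> [[y _ <-]|<-]; [rewrite isometryK|exists (Vs x)]. Qed.

Lemma is_proj_ker_isometry : is_proj dot (fun x => x - V (Vs x)).
Proof. exact: (proj_compl hilb) is_proj_range_isometry. Qed.

Lemma ker_adjoint_isometry x : Vs (x - V (Vs x)) = 0.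
Proof. by rewrite (adjointB hilb adjVs) isometryK subrr. Qed.

Lemma dot_ker_isometry x :
  dot (x - V (Vs x)) (x - V (Vs x)) = dot x x - dot (Vs x) (Vs x).
Proof.
rewrite (pythagoras hilb); first by rewrite isometry_dot.
by rewrite isometry_dot -adjVs.
Qed.

Lemma adjoint_isometry_contraction x : dot (Vs x) (Vs x) <= dot x x.
Proof. by rewrite -subr_ge0 -dot_ker_isometry (dot_ge0 hilb). Qed.

End Isometry.

(** * The Wold decomposition of an isometry *)

Section Wold.
Context {R : realType} {H : lmodType R[i]} {dot : H -> H -> R[i]}.
Hypothesis hilb : is_hilbert dot.
Context {V Vs : H -> H}.
Hypotheses (adjV : is_adjoint dot V Vs) (isoV : is_isometry dot V).

Let adjVs := adjoint_sym hilb adjV.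

Lemma iter_adjoint n : is_adjoint dot (iter n V) (iter n Vs).
Proof.
by elim: n => // n IH x y; rewrite iterS adjV IH -iterSr.
Qed.

Lemma iter_isometry n : is_isometry dot (iter n V).
Proof. by elim: n => // n IH x; rewrite iterS isoV. Qed.

Let adjn := iter_adjoint.
Let ison := iter_isometry.

Lemma iter_isometryK n : cancel (iter n V) (iter n Vs).
Proof. exact: (isometryK hilb (adjn n) (ison n)). Qed.

Definition pow_proj n x := iter n V (iter n Vs x).

Lemma is_proj_pow_proj n : is_proj dot (pow_proj n).
Proof. exact: (is_proj_range_isometry hilb (adjn n) (ison n)). Qed.

Lemma pow_proj_nested m n x : (m <= n)%N ->
  pow_proj m (pow_proj n x) = pow_proj n x.
Proof.
by move=> /subnKC <-; rewrite /pow_proj iterD iter_isometryK.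
Qed.

Lemma dot_pow_proj n x :
  dot (pow_proj n x) (pow_proj n x) = dot (iter n Vs x) (iter n Vs x).
Proof. exact: ison. Qed.

Lemma dot_pow_projB m n x : (m <= n)%N ->
  dot (pow_proj m x - pow_proj n x) (pow_proj m x - pow_proj n x)
  = dot (iter m Vs x) (iter m Vs x) - dot (iter n Vs x) (iter n Vs x).
Proof.
move=> mn; rewrite (pythagoras hilb) ?dot_pow_proj //.
have [adjm _] := is_proj_pow_proj m; have [adjn' projn] := is_proj_pow_proj n.
by rewrite -dot_pow_proj adjm pow_proj_nested // adjn' projn.
Qed.

(* The unitary part: the intersection of the ranges of the [V^n]. *)
Definition unitary_part : set H := [set x | forall n, pow_proj n x = x].

(** The projections on the decreasing ranges of the [V^n] converge at [x], and the limit is the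
    component of [x] in the intersection of these ranges. *)
Lemma wold_limit x : exists u,
  [/\ converges dot (pow_proj^~ x) u, unitary_part u &
      forall w, unitary_part w -> dot (x - u) w = 0].
Proof.
have [u xu] : exists u, converges dot (pow_proj^~ x) u.
  (* The squared norms of [V^*^n x] decrease; subtracting them from [dot x x] gives the increasing
     sequence required. *)
  apply: (pythagorean_cauchy_converges hilb _
            (fun n => dot x x - dot (iter n Vs x) (iter n Vs x)) (dot x x)).
  - move=> n; rewrite subr_ge0.
    exact: (adjoint_isometry_contraction hilb (adjn n) (ison n)).
  - by move=> n; rewrite gerBl (dot_ge0 hilb).
  - move=> m n mn.
    rewrite -opprB (dotNl hilb) (dotNr hilb) opprK dot_pow_projB //.
    by ring.
exists u; split=> // [m|w wH].
  have [adjm _] := is_proj_pow_proj m.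
  (* [pow_proj m] is a contraction that fixes the terms from index [m] on, hence it fixes the
     limit. *)
  have hc : converges dot (pow_proj m \o pow_proj^~ x) (pow_proj m u).
    apply: converges_contraction xu.
      exact: (adjointB hilb adjm).
    move=> y; rewrite dot_pow_proj.
    exact: (adjoint_isometry_contraction hilb (adjn m) (ison m)).
  apply: (converges_unique hilb) hc _; apply: eq_converges xu.
  by exists m => n mn; rewrite /= pow_proj_nested.
rewrite (dotBl hilb); apply/eqP; rewrite subr_eq0 eq_sym; apply/eqP.
apply: (converges_dot hilb) xu _; exists 0%N => n _.
by have [adjp _] := is_proj_pow_proj n; rewrite adjp wH.
Qed.

Definition wold_proj x := x - projT1 (cid (wold_limit x)).

Lemma wold_proj_compl x : unitary_part (x - wold_proj x).
Proof. by rewrite /wold_proj opprB addrC subrK; case: cid => u /= []. Qed.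

Lemma wold_proj_perp x w : unitary_part w -> dot (wold_proj x) w = 0.
Proof. by rewrite /wold_proj; case: cid => u /= [_ _]; exact. Qed.

Lemma wold_proj_id x : (forall w, unitary_part w -> dot x w = 0) ->
  wold_proj x = x.
Proof.
move=> xperp; have hu := wold_proj_compl x.
apply/eqP; rewrite eq_sym -subr_eq0; apply/eqP/(dot_eq0 hilb).
by rewrite (dotBl hilb) xperp // wold_proj_perp // subrr.
Qed.

Lemma is_proj_wold_proj : is_proj dot wold_proj.
Proof.
have key x y : dot (wold_proj x) y = dot (wold_proj x) (wold_proj y).
  apply/eqP; rewrite -subr_eq0 -(dotBr hilb) wold_proj_perp //.
  exact: wold_proj_compl.
split=> [x y|x].
  by rewrite key [RHS](dotC hilb) [in RHS]key -(dotC hilb).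
by apply: wold_proj_id => w; exact: wold_proj_perp.
Qed.

Lemma wold_proj_range x :
  range wold_proj x <-> forall w, unitary_part w -> dot x w = 0.
Proof.
split=> [[y _ <-] w|/wold_proj_id <-]; first exact: wold_proj_perp.
by exists x.
Qed.

Lemma wold_proj_compl_range x :
  range (fun x => x - wold_proj x) x <-> unitary_part x.
Proof.
split=> [[y _ <-]|ux]; first exact: wold_proj_compl.
apply/(proj_compl_range hilb _ _ is_proj_wold_proj)/(dot_eq0 hilb).
by rewrite (proj1 is_proj_wold_proj) (proj2 is_proj_wold_proj) (dot_eq0C hilb) ?wold_proj_perp.
Qed.

(** If [x = V^n y], then [T x = V^n (T y)]. *)
Lemma unitary_part_commute (T : H -> H) x :
  (forall y, T (V y) = V (T y)) -> unitary_part x -> unitary_part (T x).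
Proof.
move=> TV ux n; rewrite -{1 2}(ux n).
have -> : T (pow_proj n x) = iter n V (T (iter n Vs x)).
  by rewrite /pow_proj; elim: n (iter n Vs x) => //= n IH y; rewrite TV IH.
by rewrite /pow_proj iter_isometryK.
Qed.

Lemma unitary_part_adjoint x : unitary_part x -> unitary_part (Vs x).
Proof.
move=> ux n; apply: (isometry_inj hilb adjV isoV).
have -> : V (Vs x) = x by exact: (ux 1).
by rewrite /pow_proj -iterS -iterSr; exact: ux n.+1.
Qed.

Lemma unitary_partK x : unitary_part x -> V (Vs x) = x.
Proof. by move=> ux; exact: (ux 1). Qed.

(** The shift part of [x] is the sum of vectors [V^n c_n] with [c_n] in [ker V^*]; this is [c_n]. *)
Definition wold_coef x n := iter n Vs x - V (Vs (iter n Vs x)).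

Lemma wold_coefP n a x y :
  wold_coef (a *: x + y) n = a *: wold_coef x n + wold_coef y n.
Proof.
rewrite /wold_coef (adjointP hilb (adjoint_sym hilb (adjn n))).
by rewrite (adjointP hilb adjVs) (adjointP hilb adjV) opprD addrACA scalerBr.
Qed.

(** The sum telescopes: each term is the drop in squared norm from one [V^*^i x] to the next. *)
Lemma sum_wold_coef x n :
  \sum_(i < n) dot (wold_coef x i) (wold_coef x i)
  = dot x x - dot (iter n Vs x) (iter n Vs x).
Proof.
elim: n => [|n IH]; first by rewrite big_ord0 subrr.
rewrite big_ord_recr /= IH (dot_ker_isometry hilb adjV isoV); ring.
Qed.

(** With [sum_wold_coef], this decay says that the squared norms of the coefficients add up to
    [dot x x]. The projections of [x] on the ranges of the [V^n] tend to its unitary component,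
    which is zero. *)
Lemma wold_coef_series x : wold_proj x = x ->
  forall e, 0 < e -> exists N, forall n, (N <= n)%N ->
  dot (iter n Vs x) (iter n Vs x) < e.
Proof.
move=> px e e0; have [u [xu uu xuperp]] := wold_limit x.
suff u0 : u = 0.
  have [N HN] := xu e e0; exists N => n /HN.
  by rewrite u0 subr0 dot_pow_proj.
apply: (dot_eq0 hilb); have := xuperp u uu.
by rewrite (dotBl hilb) -px wold_proj_perp // sub0r => /eqP; rewrite oppr_eq0 => /eqP.
Qed.

Lemma wold_coef_ker n i y : Vs y = 0 ->
  wold_coef (iter i V y) n = if i == n then y else 0.
Proof.
move=> y0; rewrite /wold_coef; case: ltngtP => [lin|lni|->].
- rewrite -(subnKC lin) addSnnS addnC iterD iter_isometryK iterSr y0.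
  by rewrite (adjoint0 hilb (adjoint_sym hilb (adjn _))) (adjoint0 hilb adjVs)
    (adjoint0 hilb adjV) subrr.
- rewrite -(subnKC lni) addSnnS iterD iter_isometryK iterS.
  by rewrite (isometryK hilb adjV isoV) subrr.
- by rewrite iter_isometryK y0 (adjoint0 hilb adjV) subr0.
Qed.

Lemma dot_iter_ker i n y z : (i < n)%N -> Vs z = 0 ->
  dot (iter n V y) (iter i V z) = 0.
Proof.
move=> lin z0; rewrite -(subnKC lin) addSnnS iterD.
by rewrite (isometry_dot hilb (adjn i) (ison i)) iterS adjV z0 (dot0r hilb).
Qed.

(** The vector is the sum of the [V^i (f i)]. These terms are mutually orthogonal, so the bound on
    the squared norms makes the partial sums converge. *)
Lemma wold_coef_surj (f : nat -> H) (M : R[i]) :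
  (forall n, Vs (f n) = 0) -> (forall n, \sum_(i < n) dot (f i) (f i) <= M) ->
  exists2 x, wold_proj x = x & forall n, wold_coef x n = f n.
Proof.
move=> f0 fM; pose s n := \sum_(i < n) iter i V (f i).
have sS n : s n.+1 = s n + iter n V (f n) by rewrite /s big_ord_recr.
have dot_s n m : (m <= n)%N -> dot (iter n V (f n)) (s m) = 0.
  elim: m => [_|m IH mn]; first by rewrite /s big_ord0 (dot0r hilb).
  by rewrite sS (dotDr hilb) IH ?dot_iter_ker ?addr0 // ltnW.
have [x sx] : exists x, converges dot s x.
  apply: (pythagorean_cauchy_converges hilb s
            (fun n => \sum_(i < n) dot (f i) (f i)) M) => //.
    by move=> n; apply: sumr_ge0 => i _; exact: (dot_ge0 hilb).
  move=> m; elim=> [|n IH]; first by rewrite leqn0 => /eqP ->; rewrite !subrr (dot0l hilb).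
  rewrite leq_eqVlt => /orP[/eqP ->|mn]; first by rewrite !subrr (dot0l hilb).
  have nsm : dot (iter n V (f n)) (s n - s m) = 0.
    by rewrite (dotBr hilb) !dot_s ?subrr.
  rewrite sS addrAC big_ord_recr /= [RHS]addrAC -IH //; move: (s n - s m) nsm => d nd.
  by rewrite (dotDl hilb) !(dotDr hilb) nd (dot_eq0C hilb _ _ nd) ison addr0 add0r.
exists x.
  apply: wold_proj_id => w uw; apply: (converges_dot hilb) sx _.
  exists 0%N => n _; elim: n => [|n IH]; first by rewrite /s big_ord0 (dot0l hilb).
  rewrite sS (dotDl hilb) IH add0r -(uw n.+1); apply: (dot_eq0C hilb).
  by rewrite /pow_proj dot_iter_ker.
move=> n; have coef_s N : wold_coef (s N) n = if (n < N)%N then f n else 0.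
  elim: N => [|N IH].
    rewrite /s big_ord0 /wold_coef (adjoint0 hilb (adjoint_sym hilb (adjn _))).
    by rewrite (adjoint0 hilb adjVs) (adjoint0 hilb adjV) subrr.
  rewrite sS -[s N]scale1r wold_coefP scale1r IH wold_coef_ker // ltnS.
  by case: ltngtP => [||->]; rewrite ?addr0 ?add0r.
(* The [n]-th coefficient is a contraction in the vector, so it passes to the limit; on the partial
   sums it is [f n] from index [n + 1] on. *)
apply: (converges_unique hilb (fun N => wold_coef (s N) n)); last first.
  apply: (eventually_const_converges hilb); exists n.+1 => N nN.
  by rewrite coef_s nN.
apply: (converges_contraction (wold_coef^~ n)) sx => [y z|y].
  by rewrite addrC -scaleN1r wold_coefP scaleN1r addrC.
rewrite (dot_ker_isometry hilb adjV isoV).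
apply: le_trans (adjoint_isometry_contraction hilb (adjn n) (ison n) y).
by rewrite gerBl (dot_ge0 hilb).
Qed.

End Wold.

Arguments unitary_part {R H} V Vs.
Arguments wold_coef {R H} V Vs x n.

(** * Closed subspaces as Hilbert spaces *)

Section Subspace.
Context {F : nzRingType} {H : lmodType F} {S : {pred H}}.

(** The closure proof is an argument of the type, so that the module structure can be read off the
    type. *)
Definition subspace of submod_closed S : Type := {x : H | x \in S}.

Variable closedS : submod_closed S.

HB.instance Definition _ := [isSub of subspace closedS for @sval _ _].
HB.instance Definition _ := [Choice of subspace closedS by <:].
HB.instance Definition _ :=
  GRing.SubChoice_isSubLmodule.Build F H S (subspace closedS) closedS.

End Subspace.

Section HilbertSubspace.
Context {R : realType} {H : lmodType R[i]} {dot : H -> H -> R[i]}.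
Hypothesis hilb : is_hilbert dot.
Context {S : {pred H}}.
Variable closedS : submod_closed S.

Definition subdot (x y : subspace closedS) : R[i] := dot (val x) (val y).

Lemma is_hilbert_subspace :
  (forall u l, (forall n, u n \in S) -> converges dot u l -> l \in S) ->
  is_hilbert subdot.
Proof.
move=> limS; split.
- by move=> a x y z; rewrite /subdot linearP (dotZDl hilb).
- by move=> x y; exact: (dotC hilb).
- by move=> x; exact: (dot_ge0 hilb).
- by move=> x /(dot_eq0 hilb) x0; apply: val_inj; rewrite x0 raddf0.
- move=> u cu; have [_ _ _ _ complete] := hilb.
  have [|l ul] := complete (fun n => val (u n)).
    move=> e /cu[N HN]; exists N => m n Nm Nn.
    by rewrite -raddfB; exact: HN.
  have Sl : l \in S by apply: limS ul => n; exact: valP.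
  exists (Sub l Sl) => e /ul[N HN]; exists N => n /HN.
  by rewrite /subdot raddfB.
Qed.

End HilbertSubspace.

Arguments subdot {R H} dot {S} closedS x y.

(** Meant for series that differ in the zeroth term, which contributes [c]; hence partial sums with
    at least one term. *)
Lemma series_to_shift {R : realType} (u v : nat -> R[i]) (l m c : R[i]) :
  series_to u l -> series_to v m ->
  (forall n, \sum_(i < n.+1) u i = \sum_(i < n.+1) v i + c) -> l = m + c.
Proof.
move=> ul vm uv; apply/eqP; rewrite -subr_eq0 -normr_eq0; apply/eqP.
apply: nonneg_small_eq0 => // e e0.
have e2 : 0 < e / 2 by rewrite divr_gt0.
have [N HN] := ul _ e2; have [M HM] := vm _ e2; set n := (N + M)%N.
have := HN n.+1 (leqW (leq_addr _ _)); have := HM n.+1 (leqW (leq_addl _ _)).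
rewrite uv; set s := \sum_(i < _) _ => h1 h2.
have -> : l - (m + c) = (s - m) - (s + c - l) by ring.
apply: le_lt_trans (ler_normB _ _) _.
have -> : e = e / 2 + e / 2 by field.
by rewrite ltrD.
Qed.

(** * The BCL triple of a commuting pair *)

Section CommutingIsometries.
Context {R : realType} {H : lmodType R[i]} {dot : H -> H -> R[i]}.
Hypothesis hilb : is_hilbert dot.
Context {V1 V2 V1s V2s : H -> H}.
Hypotheses (adj1 : is_adjoint dot V1 V1s) (adj2 : is_adjoint dot V2 V2s).
Hypotheses (iso1 : is_isometry dot V1) (iso2 : is_isometry dot V2).
Hypothesis V12 : forall x, V1 (V2 x) = V2 (V1 x).

Let V := fun x => V1 (V2 x).
Let Vs := fun x => V2s (V1s x).

Let adj1s := adjoint_sym hilb adj1.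
Let adj2s := adjoint_sym hilb adj2.

Lemma product_adjoint : is_adjoint dot V Vs.
Proof. by move=> x y; rewrite /V adj1 adj2. Qed.

Lemma product_isometry : is_isometry dot V.
Proof. by move=> x; rewrite /V iso1 iso2. Qed.

Lemma adjoints_commute x : V1s (V2s x) = V2s (V1s x).
Proof.
by apply: (dot_inj hilb) => z; rewrite adj1s adj2s adj2s adj1s V12.
Qed.

Let K1 := isometryK hilb adj1 iso1.
Let K2 := isometryK hilb adj2 iso2.

(** Words are normalised with [V2] outside [V1] and [V2s] outside [V1s]; [K1'] and [K2'] are
    cancellations which this order would hide. *)
Let K1' x : V1s (V2 (V1 x)) = V2 x.
Proof. by rewrite -V12 K1. Qed.

Let K2' x : V2s (V1s (V2 x)) = V1s x.
Proof. by rewrite -adjoints_commute K2. Qed.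

Let simpl_lin :=
  (adjointN hilb adj1, adjointN hilb adj2, adjointN hilb adj1s, adjointN hilb adj2s,
   adjointD hilb adj1, adjointD hilb adj2, adjointD hilb adj1s, adjointD hilb adj2s,
   adjoint0 hilb adj1, adjoint0 hilb adj2, adjoint0 hilb adj1s, adjoint0 hilb adj2s).

Let simpl_word := (K1, K2, K1', K2', V12, adjoints_commute).

Local Ltac words := rewrite /V /Vs ?(simpl_lin, simpl_word).

(** Pairing with an arbitrary vector turns an identity of linear combinations into one of scalars,
    left to [ring]. *)
Local Ltac combination :=
  apply: (dot_inj hilb) => ?;
  rewrite ?(dotDl hilb, dotNl hilb, dot0l hilb); ring.

Let Vs_V1s x : V2s (V1s x) = 0 -> V2s (V1s (V1s x)) = 0.
Proof. by move=> x0; rewrite -adjoints_commute x0 (adjoint0 hilb adj1s). Qed.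

(* The unitary of the BCL triple, on the wandering subspace
   [ker V^* = ker V1^* + V1 ker V2^*]: it is [V2] on the first summand and
   [V1^*] on the second. *)
Definition bcl_unitary x := V2 (x - V1 (V1s x)) + V1s x.

Lemma bcl_unitary_ker x : Vs x = 0 -> Vs (bcl_unitary x) = 0.
Proof.
rewrite /Vs /bcl_unitary => x0.
by words; rewrite ?x0 ?(Vs_V1s _ x0); words; combination.
Qed.

(* Its inverse, by exchanging the roles of [V1] and [V2]. *)
Definition bcl_unitary_inv x := V1 (x - V2 (V2s x)) + V2s x.

Lemma bcl_unitary_inv_ker x : Vs x = 0 -> Vs (bcl_unitary_inv x) = 0.
Proof.
rewrite /Vs /bcl_unitary_inv => x0.
by words; rewrite ?x0 ?(Vs_V1s _ x0); words; combination.
Qed.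

Lemma bcl_unitaryK x : Vs x = 0 -> bcl_unitary_inv (bcl_unitary x) = x.
Proof.
rewrite /Vs /bcl_unitary_inv /bcl_unitary => x0.
by words; rewrite ?x0 ?(Vs_V1s _ x0); words; combination.
Qed.

Lemma bcl_unitary_invK x : Vs x = 0 -> bcl_unitary (bcl_unitary_inv x) = x.
Proof.
rewrite /Vs /bcl_unitary_inv /bcl_unitary => x0.
by words; rewrite ?x0 ?(Vs_V1s _ x0); words; combination.
Qed.

Lemma bcl_unitary_adjoint x y : Vs x = 0 -> Vs y = 0 ->
  dot (bcl_unitary x) y = dot x (bcl_unitary_inv y).
Proof.
rewrite /Vs /bcl_unitary_inv /bcl_unitary => x0 y0.
rewrite (dotDl hilb) (dotDr hilb) adj2 adj1s (adjointB hilb adj1).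
rewrite (dotBl hilb) (dotBr hilb) adj1 adjoints_commute y0 (dot0r hilb).
have -> : dot x (V1 (V2 (V2s y))) = 0 by rewrite -adj1s -adj2s x0 (dot0l hilb).
by rewrite !subr0 addrC.
Qed.

Let wandering x := x - V (Vs x).

(** This and the next three identities are the model equations on coefficients: [_0] for the
    constant one, [_S] for the later ones. In [_S], [x] stands for [V^*^n] of the original vector,
    and the left sides come from [V^* V1 = V2^*] and [V^* V2 = V1^*]. *)
Lemma wandering_V1_0 x : wandering (V1 x) =
  bcl_unitary_inv (wandering x - V2 (V2s (wandering x))).
Proof. by rewrite /wandering /bcl_unitary_inv; words; combination. Qed.

Lemma wandering_V1_S x : wandering (V2s x) =
  bcl_unitary_inv (wandering (Vs x) - V2 (V2s (wandering (Vs x))))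
  + bcl_unitary_inv (V2 (V2s (wandering x))).
Proof. by rewrite /wandering /bcl_unitary_inv; words; combination. Qed.

Lemma wandering_V2_0 x : wandering (V2 x) =
  V2 (V2s (bcl_unitary (wandering x))).
Proof. by rewrite /wandering /bcl_unitary; words; combination. Qed.

Lemma wandering_V2_S x : wandering (V1s x) =
  V2 (V2s (bcl_unitary (wandering (Vs x))))
  + (bcl_unitary (wandering x) - V2 (V2s (bcl_unitary (wandering x)))).
Proof. by rewrite /wandering /bcl_unitary; words; combination. Qed.

Let adjV := product_adjoint.
Let isoV := product_isometry.
Let adjVs := adjoint_sym hilb adjV.

Definition ker_pred : {pred H} := [pred x | `[< Vs x = 0 >]].

Lemma ker_predP x : reflect (Vs x = 0) (x \in ker_pred).
Proof. exact: asboolP. Qed.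

Lemma ker_submod : submod_closed ker_pred.
Proof.
split=> [|a x y]; first by apply/ker_predP; exact: (adjoint0 hilb adjVs).
move=> /ker_predP x0 /ker_predP y0; apply/ker_predP.
by rewrite (adjointP hilb adjVs) x0 y0 scaler0 addr0.
Qed.

Let E : lmodType R[i] := subspace ker_submod.
Let dotE : E -> E -> R[i] := subdot dot ker_submod.

Lemma ker_subspace_hilbert : is_hilbert dotE.
Proof.
apply: (is_hilbert_subspace hilb) => u l u0 ul; apply/ker_predP.
apply: (converges_unique hilb (Vs \o u)); last first.
  apply: (eventually_const_converges hilb); exists 0%N => n _.
  exact/ker_predP/u0.
apply: converges_contraction ul; first exact: (adjointB hilb adjVs).
exact: (adjoint_isometry_contraction hilb adjV isoV).
Qed.

Lemma ker_valP (e : E) : Vs (val e) = 0.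
Proof. exact/ker_predP/(valP e). Qed.

Lemma wandering_ker x : wandering x \in ker_pred.
Proof. exact/ker_predP/(ker_adjoint_isometry hilb adjV isoV). Qed.

Lemma wandering_id x : Vs x = 0 -> wandering x = x.
Proof.
by rewrite /wandering => ->; rewrite (adjoint0 hilb adjV) subr0.
Qed.

(** Projecting first makes the map total, so that it also yields coefficients when applied to
    [V^*^n x]. *)
Definition to_ker x : E := Sub (wandering x) (wandering_ker x).

Lemma val_to_ker x : Vs x = 0 -> val (to_ker x) = x.
Proof. by move=> x0; rewrite SubK wandering_id. Qed.

Definition bcl_P (e : E) : E := to_ker (V2 (V2s (val e))).
Definition bcl_U (e : E) : E := to_ker (bcl_unitary (val e)).
Definition bcl_Us (e : E) : E := to_ker (bcl_unitary_inv (val e)).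

Lemma val_bcl_P e : val (bcl_P e) = V2 (V2s (val e)).
Proof.
apply: val_to_ker; have := ker_valP e; rewrite /Vs => e0.
by words; rewrite ?e0; words.
Qed.

Lemma val_bcl_U e : val (bcl_U e) = bcl_unitary (val e).
Proof. exact/val_to_ker/bcl_unitary_ker/ker_valP. Qed.

Lemma val_bcl_Us e : val (bcl_Us e) = bcl_unitary_inv (val e).
Proof. exact/val_to_ker/bcl_unitary_inv_ker/ker_valP. Qed.

Let Hu : set H := unitary_part V Vs.
Let Q := wold_proj hilb adjV isoV.
Let W x n : E := to_ker (iter n Vs x).

Let Hu_Vs x : Hu x -> Hu (Vs x).
Proof. exact: (unitary_part_adjoint hilb adjV isoV). Qed.

Let Hu_V1 x : Hu x -> Hu (V1 x).
Proof.
by apply: (unitary_part_commute hilb adjV isoV) => y; rewrite /V -V12.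
Qed.

Let Hu_V2 x : Hu x -> Hu (V2 x).
Proof.
by apply: (unitary_part_commute hilb adjV isoV) => y; rewrite /V -V12.
Qed.

Let HuK x : Hu x -> V (Vs x) = x.
Proof. exact: unitary_partK. Qed.

(** On the unitary part [V V^*] is the identity, so [V1^* = V2 V^*] there. *)
Let Hu_V1s x : Hu x -> Hu (V1s x).
Proof.
by move=> ux; rewrite -(HuK _ ux) /V K1; exact/Hu_V2/Hu_Vs.
Qed.

Let Hu_V2s x : Hu x -> Hu (V2s x).
Proof.
by move=> ux; rewrite -(HuK _ ux) /V V12 K2; exact/Hu_V1/Hu_Vs.
Qed.

(** The range of [Q] is the orthogonal complement of the unitary part, which [Ts] preserves. *)
Let Hp_invariant (T Ts : H -> H) : is_adjoint dot T Ts ->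
  (forall x, Hu x -> Hu (Ts x)) -> T @` range Q `<=` range Q.
Proof.
move=> adjT uTs _ [x /wold_proj_range xp <-].
by apply/wold_proj_range => w uw; rewrite adjT xp //; exact: uTs.
Qed.

Let Hu_invariant (T : H -> H) : (forall x, Hu x -> Hu (T x)) ->
  T @` range (fun x => x - Q x) `<=` range (fun x => x - Q x).
Proof.
move=> uT _ [x /wold_proj_compl_range ux <-].
by apply/wold_proj_compl_range; exact: uT.
Qed.

Lemma hardy_wold_coef x : hardy dotE (W x).
Proof.
exists (dot x x) => n; rewrite (sum_wold_coef hilb adjV isoV).
by rewrite gerBl (dot_ge0 hilb).
Qed.

Lemma is_proj_bcl_P : is_proj dotE bcl_P.
Proof.
split=> [x y|x].
  by rewrite /dotE /subdot !val_bcl_P adj2 adj2s.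
by apply: val_inj; rewrite !val_bcl_P K2.
Qed.

Let valD (e f : E) : val (e + f) = val e + val f. Proof. exact: raddfD. Qed.
Let valB (e f : E) : val (e - f) = val e - val f. Proof. exact: raddfB. Qed.
Let val0 : val (0 : E) = 0. Proof. exact: raddf0. Qed.

Let iter_Vs_commute (T : H -> H) n x : (forall y, T (Vs y) = Vs (T y)) ->
  iter n Vs (T x) = T (iter n Vs x).
Proof. by move=> TVs; elim: n => //= n ->. Qed.

Let val_W x n : val (W x n) = wandering (iter n Vs x).
Proof. by []. Qed.

Let Vs_V1 x : Vs (V1 x) = V2s x. Proof. by rewrite /Vs K1. Qed.

Lemma W_V1 x : W (V1 x) = M_phi1 bcl_P bcl_Us (W x).
Proof.
apply: funext => n; apply: val_inj; rewrite /M_phi1 /mult_lin valD.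
rewrite !val_bcl_Us valB !val_bcl_P; case: n => [|n].
  rewrite val0 !val_W wandering_V1_0.
  suff -> : bcl_unitary_inv (V2 (V2s 0)) = 0 by rewrite addr0.
  by rewrite /bcl_unitary_inv; words; combination.
rewrite !val_W [iter n.+1 Vs (V1 x)]iterSr [Vs (V1 x)]Vs_V1 iter_Vs_commute; last first.
  by move=> y; rewrite /Vs adjoints_commute.
exact: wandering_V1_S.
Qed.

Lemma W_V2 x : W (V2 x) = M_phi2 bcl_P bcl_U (W x).
Proof.
apply: funext => n; apply: val_inj; rewrite /M_phi2 /mult_lin valD.
rewrite valB !val_bcl_P !val_bcl_U; case: n => [|n].
  rewrite val0 !val_W wandering_V2_0.
  suff -> : bcl_unitary 0 = 0 by rewrite (adjoint0 hilb adj2s) (adjoint0 hilb adj2) subrr addr0.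
  by rewrite /bcl_unitary; words; combination.
rewrite !val_W [iter n.+1 Vs (V2 x)]iterSr [Vs (V2 x)]K2' iter_Vs_commute; last first.
  by move=> y; rewrite /Vs adjoints_commute.
exact: wandering_V2_S.
Qed.

Lemma BCL_triple_exists :
  BCL_triple dot V1 V2 V1s V2s dotE bcl_P bcl_U bcl_Us.
Proof.
split; first exact: ker_subspace_hilbert.
- exact: is_proj_bcl_P.
- split.
    move=> x y; rewrite /dotE /subdot val_bcl_U val_bcl_Us.
    by rewrite bcl_unitary_adjoint ?ker_valP.
  by split=> x; apply: val_inj; rewrite !(val_bcl_U, val_bcl_Us)
    ?bcl_unitaryK ?bcl_unitary_invK ?ker_valP.
exists Q, W; split.
- exact: is_proj_wold_proj.
- split; split; try exact: Hu_invariant.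
  + exact: Hp_invariant adj1 Hu_V1s.
  + exact: Hp_invariant adj1s Hu_V1.
  + exact: Hp_invariant adj2 Hu_V2s.
  + exact: Hp_invariant adj2s Hu_V2.
- split; apply/seteqP; split; try exact: Hu_invariant.
  + move=> x /wold_proj_compl_range ux; exists (V1s x).
      by apply/wold_proj_compl_range/Hu_V1s.
    by rewrite -[in LHS](HuK _ ux) /V K1; exact: HuK.
  + move=> x /wold_proj_compl_range ux; exists (V2s x).
      by apply/wold_proj_compl_range/Hu_V2s.
    by rewrite -[in LHS](HuK _ ux) /V V12 K2 -V12; exact: HuK.
- split.
  + move=> a x y _ _ n; apply: val_inj; rewrite linearP /=.
    exact: (wold_coefP hilb adjV).
  + by move=> x _; exact: hardy_wold_coef.
  + move=> x /(proj_range _ _ (is_proj_wold_proj hilb adjV isoV)) px e e0.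
    (* The partial sums miss [dot x x] by exactly the squared norm of [V^*^n x]. *)
    have [N HN] := wold_coef_series hilb adjV isoV x px e e0.
    exists N => n /HN; rewrite (sum_wold_coef hilb adjV isoV).
    by rewrite addrAC subrr sub0r normrN ger0_norm // (dot_ge0 hilb).
  + move=> f [M fM].
    have [x px xf] := wold_coef_surj hilb adjV isoV (val \o f) M
      (fun n => ker_valP (f n)) fM.
    exists x; first by rewrite -px; exists x.
    by apply: funext => n; apply: val_inj; exact: xf.
- by move=> x _; split; [exact: W_V1|exact: W_V2].
Qed.

(** * The implications between the five conditions *)

Let A x := x - V1 (V1s x).
Let B x := x - V2 (V2s x).

Let projA : is_proj dot A := is_proj_ker_isometry hilb adj1 iso1.
Let projB : is_proj dot B := is_proj_ker_isometry hilb adj2 iso2.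

Let V1s_A x : V1s (A x) = 0.
Proof. exact: (ker_adjoint_isometry hilb adj1 iso1). Qed.

Let V2s_B x : V2s (B x) = 0.
Proof. exact: (ker_adjoint_isometry hilb adj2 iso2). Qed.

Let A_id x : V1s x = 0 -> A x = x.
Proof. by rewrite /A => ->; rewrite (adjoint0 hilb adj1) subr0. Qed.

Let B_id x : V2s x = 0 -> B x = x.
Proof. by rewrite /B => ->; rewrite (adjoint0 hilb adj2) subr0. Qed.

Let range_A : range A = ker V1s.
Proof.
by apply/seteqP; split=> [_ [x _ <-]|x /A_id <-]; [exact: V1s_A|exists x].
Qed.

Let range_B : range B = ker V2s.
Proof.
by apply/seteqP; split=> [_ [x _ <-]|x /B_id <-]; [exact: V2s_B|exists x].
Qed.

Let range_wandering : range wandering = ker Vs.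
Proof.
apply/seteqP; split=> [_ [x _ <-]|x /wandering_id <-]; last by exists x.
exact: (ker_adjoint_isometry hilb adjV isoV).
Qed.

Let equal_ranges := range V1 = range V2.
Let equal_kernel_images := V1 @` ker V2s = V2 @` ker V1s.
Let defect_difference := exists P1 P2 : H -> H,
  [/\ is_proj dot P1, is_proj dot P2,
      (forall x y, dot (P1 x) (P2 y) = 0),
      (forall x, defect V1 V2 V1s V2s x = P1 x - P2 x) &
      [set P1 x + P2 y | x in setT & y in setT] = ker Vs].
Let zero_fringes :=
  (forall Pk1 : H -> H, is_proj dot Pk1 -> range Pk1 = ker V1s ->
     forall x, ker V1s x -> Pk1 (V2 x) = 0) /\
  (forall Pk2 : H -> H, is_proj dot Pk2 -> range Pk2 = ker V2s ->
     forall x, ker V2s x -> Pk2 (V1 x) = 0).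

(** If [V1 x = V2 y], then [V1^* y = V1^* V2^* V1 x = V2^* x]; the other inclusion is symmetric. *)
Lemma kernel_images_of_ranges : equal_ranges -> equal_kernel_images.
Proof.
move=> r12; apply/seteqP; split=> _ [x x0 <-].
- have [y _ xy] : range V2 (V1 x) by rewrite -r12; exists x.
  exists y => //; rewrite /ker /= -(K2 y) xy adjoints_commute K1; exact: x0.
- have [y _ xy] : range V1 (V2 x) by rewrite r12; exists x.
  exists y => //; rewrite /ker /= -(K1 y) xy -adjoints_commute K2; exact: x0.
Qed.

Lemma defect_of_kernel_images : equal_kernel_images -> defect_difference.
Proof.
move=> k12; exists A, (fun x => V2 (A (V2s x))); split=> //.
- split=> [x y|x]; first by rewrite adj2 (proj1 projA) adj2s.
  by rewrite K2 (proj2 projA).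
- move=> x y.
  have [w w0 <-] : (V1 @` ker V2s) (V2 (A (V2s y))).
    by rewrite k12; exists (A (V2s y)) => //; exact: V1s_A.
  by rewrite -adj1s V1s_A (dot0l hilb).
- by move=> x; rewrite /defect /A; words; combination.
- apply/seteqP; split=> [_ [x _ [y _ <-]]|z z0].
    by rewrite /ker /= (adjointD hilb adjVs) /Vs V1s_A K2' V1s_A
      (adjoint0 hilb adj2s) addr0.
  (* Write [z = A z + V1 V1^* z]. As [V1^* z] is in [ker V2^*], (b) gives the second summand the
     form [V2 w] with [w] in [ker V1^*]. *)
  have [w w0 zw] : (V2 @` ker V1s) (V1 (V1s z)).
    by rewrite -k12; exists (V1s z).
  exists z => //; exists (V2 w) => //.
  by rewrite K2 (A_id w) // zw /A subrK.
Qed.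

(* Adding [P1 + P2 = I - V V^*] to [P1 - P2 = C(V1, V2)] gives [2 P1 = A + B]
   with [A], [B] the projections on [ker V1^*], [ker V2^*]; then [P1] being
   idempotent means [(A - B)^2 = 0]. *)
Lemma ker_projections_of_defect : defect_difference -> forall x, A x = B x.
Proof.
move=> [P1 [P2 [proj1 proj2 P12 defP ranP]]].
have [adjP1 P1P1] := proj1; have [adjP2 P2P2] := proj2.
have P1P2 x : P1 (P2 x) = 0.
  by apply: (dot_inj hilb) => z; rewrite adjP1 (dot_eq0C hilb) ?P12 ?(dot0l hilb).
have P2P1 x : P2 (P1 x) = 0.
  by apply: (dot_inj hilb) => z; rewrite adjP2 P12 (dot0l hilb).
(* [S] is a projection with range [ker V^*], so it equals [I - V V^*]. *)
pose S x := P1 x + P2 x.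
have SP x y : S (P1 x + P2 y) = P1 x + P2 y.
  by rewrite /S (adjointD hilb adjP1) (adjointD hilb adjP2) P1P1 P2P2 P1P2 P2P1
     addr0 add0r.
have projS : is_proj dot S.
  by split=> [x y|x]; rewrite ?SP // (dotDl hilb) (dotDr hilb) adjP1 adjP2.
have Swan : forall x, S x = wandering x.
  apply: (proj_range_inj hilb _ _ projS (is_proj_ker_isometry hilb adjV isoV)).
  rewrite range_wandering -ranP; apply/seteqP; split=> [_ [x _ <-]|_ [x _ [y _ <-]]].
    by exists x => //; exists x.
  by exists (P1 x + P2 y); rewrite ?SP.
pose T x := A x + B x.
have TP1 x : T x = P1 x + P1 x.
  have -> : P1 x + P1 x = S x + (P1 x - P2 x) by rewrite /S; combination.
  rewrite Swan -defP /defect /wandering /T /A /B; words.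
  by combination.
have TT x : T (T x) = T x + T x.
  by rewrite [T x]TP1 TP1 (adjointD hilb adjP1) P1P1.
have [adjA AA] := projA; have [adjB BB] := projB.
move=> x; apply/eqP; rewrite -subr_eq0; apply/eqP/(dot_eq0 hilb).
rewrite (dotBl hilb) adjA adjB -(dotBr hilb).
suff -> : A (A x - B x) - B (A x - B x) = 0 by rewrite (dot0r hilb).
(* The left side expands to [2 T x - T (T x)], which [TT] makes vanish. *)
rewrite -[RHS](subrr (T (T x))) {1}TT /T.
rewrite (adjointB hilb adjA (A x) (B x)) (adjointB hilb adjB (A x) (B x)).
rewrite (adjointD hilb adjA (A x) (B x)) (adjointD hilb adjB (A x) (B x)).
by rewrite AA BB; combination.
Qed.

(** Once [A = B], the projection on [ker V1^*] is also [I - V2 V2^*], which kills the range of [V2];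
    likewise for the other fringe operator. *)
Lemma zero_fringes_of_defect : defect_difference -> zero_fringes.
Proof.
move/ker_projections_of_defect => AB.
split=> Pk projP rP x _.
  have -> : Pk (V2 x) = A (V2 x).
    by apply: (proj_range_inj hilb _ _ projP projA); rewrite rP range_A.
  by rewrite AB /B K2 subrr.
have -> : Pk (V1 x) = B (V1 x).
  by apply: (proj_range_inj hilb _ _ projP projB); rewrite rP range_B.
by rewrite -AB /A K1 subrr.
Qed.

(** The exchange of [ran P] and its complement by [U] is translated into [ker V1^* = ker V2^*], and
    the ranges are the orthogonal complements of these kernels. *)
Lemma ranges_of_bcl : bcl_U @` range bcl_P = range (fun x => x - bcl_P x) ->
  equal_ranges.
Proof.
move=> UP; have hilbE := ker_subspace_hilbert.
have [adjP PP] := is_proj_bcl_P.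
have projPc := proj_compl_range hilbE _ _ is_proj_bcl_P.
have UB (e f : E) : bcl_U (e - f) = bcl_U e - bcl_U f.
  apply: val_inj; rewrite valB !val_bcl_U valB /bcl_unitary.
  by words; combination.
have U_inj : injective bcl_U.
  move=> e f /(congr1 val); rewrite !val_bcl_U => ef; apply: val_inj.
  by rewrite -[val e]bcl_unitaryK ?ef ?bcl_unitaryK ?ker_valP.
have dotU (e f : E) : dotE (bcl_U e) (bcl_U f) = dotE e f.
  by rewrite /dotE /subdot !val_bcl_U bcl_unitary_adjoint ?bcl_unitaryK
     ?bcl_unitary_ker ?ker_valP.
have PUP e : bcl_P (bcl_U (bcl_P e)) = 0.
  by apply/projPc; rewrite -UP; exists (bcl_P e) => //; exists e.
(* The defect [r] of [U e] from [ran P] is itself [U f] with [f] in [ran P], so its squared norm is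
   the product of [e] and [f], which vanishes when [P e = 0]. *)
have PU e : bcl_P e = 0 -> bcl_P (bcl_U e) = bcl_U e.
  move=> e0; apply/eqP; rewrite eq_sym -subr_eq0; apply/eqP/(dot_eq0 hilbE).
  set r := _ - _; have [_ [f _ <-] fr] : (bcl_U @` range bcl_P) r.
    by rewrite UP; exists (bcl_U e).
  have Pr : bcl_P r = 0 by apply/projPc; exists (bcl_U e).
  rewrite {1}/r (dotBl hilbE) adjP Pr (dot0r hilbE) subr0 -fr dotU.
  by rewrite -adjP e0 (dot0l hilbE).
have k12 x : V1s x = 0 -> V2s x = 0.
  move=> x0; have Vx : Vs x = 0 by rewrite /Vs x0 (adjoint0 hilb adj2s).
  have Ux : val (bcl_U (to_ker x)) = V2 x.
    by rewrite val_bcl_U val_to_ker // /bcl_unitary x0; words; combination.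
  have PUx : bcl_P (bcl_U (to_ker x)) = bcl_U (to_ker x).
    by apply: val_inj; rewrite val_bcl_P Ux K2.
  (* Here [U x = V2 x] lies in [ran P]. So does [U (x - P x)], whereas [U (P x)] is killed by [P];
     hence [U (P x) = 0]. *)
  have Px : bcl_P (to_ker x) = 0.
    set e := to_ker x in PUx *.
    have Pc : bcl_P (e - bcl_P e) = 0 by apply/projPc; exists e.
    have := PU _ Pc; rewrite UB (adjointB hilbE adjP) PUP subr0 PUx.
    move=> /eqP; rewrite -subr_eq0 subKr => /eqP U0.
    by apply: U_inj; rewrite U0 -[X in bcl_U X](subrr 0) UB subrr.
  have := congr1 val Px; rewrite val_bcl_P val_to_ker // val0 => V2x.
  by rewrite -[LHS]K2 V2x (adjoint0 hilb adj2s).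
have k21 x : V2s x = 0 -> V1s x = 0.
  move=> x0; have Vx : Vs x = 0.
    by rewrite /Vs -adjoints_commute x0 (adjoint0 hilb adj1s).
  have Px : bcl_P (to_ker x) = 0.
    by apply: val_inj; rewrite val_bcl_P val_to_ker // x0 (adjoint0 hilb adj2).
  have := congr1 val (PU _ Px); rewrite val_bcl_P val_bcl_U val_to_ker //.
  rewrite /bcl_unitary (adjointD hilb adj2s) K2 [V2s (V1s x)]Vx addr0.
  by move/eqP; rewrite -subr_eq0 opprD addrA subrr sub0r oppr_eq0 => /eqP.
apply/seteqP; split=> _ [x _ <-].
  apply/(isometry_range hilb adj2 iso2)/eqP; rewrite eq_sym -subr_eq0.
  apply/eqP/(dot_eq0 hilb); rewrite -/(B _) (proj1 projB) (proj2 projB).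
  by rewrite adj1 k21 ?V2s_B ?(dot0r hilb).
apply/(isometry_range hilb adj1 iso1)/eqP; rewrite eq_sym -subr_eq0.
apply/eqP/(dot_eq0 hilb); rewrite -/(A _) (proj1 projA) (proj2 projA).
by rewrite adj2 k12 ?V1s_A ?(dot0r hilb).
Qed.

Lemma ranges_of_BCL_triples :
  (forall (E' : lmodType R[i]) (dotE' : E' -> E' -> R[i]) (P U Us : E' -> E'),
    BCL_triple dot V1 V2 V1s V2s dotE' P U Us ->
    U @` range P = range (fun x => x - P x)) -> equal_ranges.
Proof. by move/(_ _ _ _ _ _ BCL_triple_exists)/ranges_of_bcl. Qed.

Lemma ranges_of_zero_fringes : zero_fringes ->
  (forall x, V1s x = 0 -> range V1 (V2 x)) /\
  (forall x, V2s x = 0 -> range V2 (V1 x)).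
Proof.
case=> F1 F2; split=> x x0.
  exists (V1s (V2 x)) => //; apply/eqP; rewrite eq_sym -subr_eq0; apply/eqP.
  exact: (F1 A projA range_A).
exists (V2s (V1 x)) => //; apply/eqP; rewrite eq_sym -subr_eq0; apply/eqP.
exact: (F2 B projB range_B).
Qed.

Lemma bcl_of_zero_fringes (E' : lmodType R[i]) (dotE' : E' -> E' -> R[i])
    (P U Us : E' -> E') :
  zero_fringes -> BCL_triple dot V1 V2 V1s V2s dotE' P U Us ->
  U @` range P = range (fun x => x - P x).
Proof.
move=> /ranges_of_zero_fringes[F1 F2] [hilbE projP [adjU [UK KU]] [Q' [W' []]]].
move=> projQ [[pV1 pV1s pV2 pV2s] [uV1 _ uV2 _]] _ [W'lin _ W'dot W'surj] W'V.
have [adjP PP] := projP.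
have U0 := adjoint0 hilbE adjU.
have P0 := adjoint0 hilbE adjP.
have adjUs := adjoint_sym hilbE adjU.
have Us0 := adjoint0 hilbE adjUs.
have PPc e : P (e - P e) = 0 by rewrite (adjointB hilbE adjP) PP subrr.
have constH (e : E') : exists2 y, range Q' y & W' y = (fun n => if n is 0 then e else 0).
  apply: W'surj; exists (dotE' e e) => -[|n]; first by rewrite big_ord0 (dot_ge0 hilbE).
  by rewrite big_ord_recl big1 ?addr0 //= => i _; rewrite (dot0l hilbE).
(* Constants are the only vectors whose inner products are needed below. *)
have dot_const x y e : range Q' x -> range Q' y ->
    W' y = (fun n => if n is 0 then e else 0) -> dot x y = dotE' (W' x 0) e.
  move=> px py Wy; apply: (polarization hilb hilbE) => a.
  have pz : range Q' (a *: y + x).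
    move: px py => /(proj_range _ _ projQ) px /(proj_range _ _ projQ) py.
    by apply/(proj_range _ _ projQ); rewrite (adjointP hilb (proj1 projQ)) px py.
  apply/eqP; rewrite subr_eq -addrA; apply/eqP.
  (* Adding a multiple of the constant [y] changes the zeroth coefficient alone. *)
  apply: series_to_shift (W'dot _ pz) (W'dot _ px) _ => n.
  rewrite !big_ord_recl W'lin // Wy /=.
  have -> : \sum_(i < n) dotE' (W' (a *: y + x) (bump 0 i)) (W' (a *: y + x) (bump 0 i))
          = \sum_(i < n) dotE' (W' x (bump 0 i)) (W' x (bump 0 i)).
    by apply: eq_bigr => i _; rewrite W'lin // Wy /= scaler0 add0r.
  by ring.
(* It suffices to test [Ts y] on the range of [Q']: on the complement, [T] stays in the complement,
   which is orthogonal to [y]. *)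
have perp (T Ts : H -> H) y : is_adjoint dot T Ts -> range Q' y ->
    T @` range (fun x => x - Q' x) `<=` range (fun x => x - Q' x) ->
    (forall x, range Q' x -> dot (T x) y = 0) -> Ts y = 0.
  move=> adjT /(proj_range _ _ projQ) py uT Ty; apply: (dot_eq0 hilb).
  rewrite -adjT; move: (Ts y) => z.
  rewrite -(subrK (Q' z) z) (adjointD hilb adjT) (dotDl hilb) (Ty (Q' z)) ?addr0; last by exists z.
  have [w _ <-] := uT (T (z - Q' z)) (ex_intro2 _ _ _ (ex_intro2 _ _ z I erefl) erefl).
  by rewrite -py -(proj1 projQ) (adjointB hilb (proj1 projQ)) (proj2 projQ) subrr (dot0l hilb).
have W1_0 x : range Q' x -> W' (V1 x) 0 = Us (W' x 0 - P (W' x 0)).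
  by move=> /W'V[-> _]; rewrite /M_phi1 /mult_lin /= P0 Us0 addr0.
have W2_0 x : range Q' x -> W' (V2 x) 0 = P (U (W' x 0)).
  by move=> /W'V[_ ->]; rewrite /M_phi2 /mult_lin /= U0 P0 subrr addr0.
apply/seteqP; split=> [_ [_ [e _ <-] <-]|_ [e _ <-]].
(* This constant is in [ker V1^*], so (d) gives [V2 y = V1 z]. Comparing zeroth coefficients, [P e]
   is [U^*] of the component of [W' z 0] in the range of [I - P]. *)
- have [y py Wy] := constH (Us (P e)).
  have y0 : V1s y = 0.
    apply: (perp _ _ _ adj1 py uV1) => x px.
    rewrite (dot_const _ _ _ _ py Wy); last by apply: pV1; exists x.
    by rewrite W1_0 // adjUs UK -adjP PPc (dot0l hilbE).
  have [z _ zy] := F1 _ y0.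
  have pz : range Q' z by rewrite -(K1 z) zy; apply: pV1s; exists (V2 y) => //; apply: pV2; exists y.
  exists (W' z 0) => //.
  by rewrite -[LHS]UK -W1_0 // zy W2_0 // Wy UK PP.
(* This constant is in [ker V2^*], so [V1 y = V2 z], and the zeroth coefficients give
   [U^* (e - P e) = P (U (W' z 0))]. *)
- have [y py Wy] := constH (e - P e).
  have y0 : V2s y = 0.
    apply: (perp _ _ _ adj2 py uV2) => x px.
    rewrite (dot_const _ _ _ _ py Wy); last by apply: pV2; exists x.
    by rewrite W2_0 // adjP PPc (dot0r hilbE).
  have [z _ zy] := F2 _ y0.
  have pz : range Q' z by rewrite -(K2 z) zy; apply: pV2s; exists (V1 y) => //; apply: pV1; exists y.
  exists (P (U (W' z 0))); first by exists (U (W' z 0)).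
  by rewrite -W2_0 // zy W1_0 // Wy UK PPc subr0.
Qed.

End CommutingIsometries.

Theorem theorem5p3 (R : realType) (H : lmodType R[i]) (dot : H -> H -> R[i])
    (V1 V2 V1s V2s : H -> H) :
  is_hilbert dot ->
  is_adjoint dot V1 V1s -> is_adjoint dot V2 V2s ->
  is_isometry dot V1 -> is_isometry dot V2 ->
  (forall x, V1 (V2 x) = V2 (V1 x)) ->
  (* V = V1 V2, so V^* = V2^* V1^* *)
  let Vs := fun x => V2s (V1s x) in
  [<->
    (* (a) *) range V1 = range V2;
    (* (b) *) V1 @` ker V2s = V2 @` ker V1s;
    (* (c) *) exists P1 P2 : H -> H,
                [/\ is_proj dot P1, is_proj dot P2,
                    (forall x y, dot (P1 x) (P2 y) = 0),
                    (forall x, defect V1 V2 V1s V2s x = P1 x - P2 x) &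
                    [set P1 x + P2 y | x in setT & y in setT] = ker Vs];
    (* (d) *) (forall Pk1 : H -> H, is_proj dot Pk1 -> range Pk1 = ker V1s ->
                 forall x, ker V1s x -> Pk1 (V2 x) = 0) /\
              (forall Pk2 : H -> H, is_proj dot Pk2 -> range Pk2 = ker V2s ->
                 forall x, ker V2s x -> Pk2 (V1 x) = 0);
    (* (e) *) forall (E : lmodType R[i]) (dotE : E -> E -> R[i]) (P U Us : E -> E),
                BCL_triple dot V1 V2 V1s V2s dotE P U Us ->
                U @` range P = range (fun x => x - P x)].
Proof.
move=> hilb adj1 adj2 iso1 iso2 V12 Vs; tfae.
- exact: (kernel_images_of_ranges hilb adj1 adj2 iso1 iso2 V12).
- exact: (defect_of_kernel_images hilb adj1 adj2 iso1 iso2 V12).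
- exact: (zero_fringes_of_defect hilb adj1 adj2 iso1 iso2 V12).
- move=> fr E dotE P U Us.
  exact: (bcl_of_zero_fringes hilb adj1 adj2 iso1 iso2 _ _ _ _ _ fr).
- exact (ranges_of_BCL_triples hilb adj1 adj2 iso1 iso2 V12).
Qed.
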